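(* For every integer $s>2$ there exist uncountably many ergodic $\mathfrak{S}^{\mathbb{N}}$-invariant Borel probability measures on the set of graphs with vertex set $\mathbb{N}$ that are concentrated on the set of universal $K_s$-free graphs.
   Context: Graphs are undirected, without loops or multiple edges. Graphs with vertex set $\mathbb{N}$ are identified with their adjacency matrices, i.e. infinite symmetric $\{0,1\}$-matrices with zero diagonal, with the weak (product) topology and its Borel $\sigma$-field. $\mathfrak{S}^{\mathbb{N}}$ is the group of all permutations of $\mathbb{N}$, acting by simultaneous permutation of rows and columns. $K_s$ is the complete graph on $s$ vertices; a graph is $K_s$-free if it contains no $K_s$. A countable $K_s$-free graph $\Gamma$ is universal $K_s$-free (homogeneous) if every finite $K_s$-free graph embeds in $\Gamma$ as an induced subgraph and every isomorphism between two finite induced subgraphs of $\Gamma$ extends to an automorphism of $\Gamma$. *)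

(* Defs.v *)
From HB Require Import structures.
From mathcomp Require Import all_boot all_order all_algebra.
From mathcomp Require Import all_classical all_reals all_analysis.

Set Implicit Arguments.
Unset Strict Implicit.
Unset Printing Implicit Defensive.

Local Open Scope classical_set_scope.

Record sgraph (V : Type) := SGraph {
  adj :> rel V;
  adj_sym : symmetric adj;
  adj_irr : irreflexive adj }.

Lemma empty_sym (V : Type) : symmetric (fun _ _ : V => false).
Proof. by []. Qed.

Lemma empty_irr (V : Type) : irreflexive (fun _ _ : V => false).
Proof. by []. Qed.

Definition empty_graph (V : Type) : sgraph V :=
  SGraph (@empty_sym V) (@empty_irr V).

Lemma complete_sym (s : nat) : symmetric (fun i j : 'I_s => i != j).
Proof. by move=> i j; rewrite eq_sym. Qed.

Lemma complete_irr (s : nat) : irreflexive (fun i j : 'I_s => i != j).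
Proof. by move=> i; rewrite eqxx. Qed.

Definition complete_graph (s : nat) : sgraph 'I_s :=
  SGraph (@complete_sym s) (@complete_irr s).

Definition embeds (V W : Type) (H : sgraph V) (G : sgraph W) : Prop :=
  exists f : V -> W, injective f /\ forall x y, G (f x) (f y) = H x y.

(* For the complete graph, subgraphs and induced subgraphs coincide. *)
Definition Kfree (s : nat) (V : Type) (G : sgraph V) : Prop :=
  ~ embeds (complete_graph s) G.

Definition ngraph := sgraph nat.

Definition adjmx (G : ngraph) : prod_topology (fun _ : nat * nat => bool) :=
  fun ij => G ij.1 ij.2.

HB.instance Definition _ := gen_eqMixin ngraph.
HB.instance Definition _ := gen_choiceMixin ngraph.
HB.instance Definition _ := isPointed.Build ngraph (empty_graph nat).
HB.instance Definition _ := Topological.copy ngraph (initial_topology adjmx).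

Definition borel_ngraph := g_sigma_algebraType (@open ngraph).

Definition automorphism (G : ngraph) (h : nat -> nat) : Prop :=
  bijective h /\ forall x y, G (h x) (h y) = G x y.

(* An isomorphism between the subgraphs induced on A and B is given by the
   restriction to A of a function f : nat -> nat. *)
Definition homogeneous (G : ngraph) : Prop :=
  forall (A B : set nat) (f : nat -> nat),
    finite_set A -> finite_set B -> set_bij A B f ->
    (forall x y, A x -> A y -> G (f x) (f y) = G x y) ->
    exists h : nat -> nat, automorphism G h /\ forall x, A x -> h x = f x.

Definition universal_Kfree (s : nat) (G : ngraph) : Prop :=
  [/\ Kfree s G,
      forall (V : finType) (H : sgraph V), Kfree s H -> embeds H G
    & homogeneous G].

Lemma permute_sym (p : nat -> nat) (G : ngraph) :
  symmetric (fun i j => G (p i) (p j)).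
Proof. by move=> i j; rewrite adj_sym. Qed.

Lemma permute_irr (p : nat -> nat) (G : ngraph) :
  irreflexive (fun i j => G (p i) (p j)).
Proof. by move=> i; rewrite adj_irr. Qed.

Definition permute (p : nat -> nat) (G : borel_ngraph) : borel_ngraph :=
  SGraph (permute_sym p G) (permute_irr p G).

Local Open Scope ereal_scope.

Definition perm_invariant (R : realType) (mu : probability borel_ngraph R) :=
  forall p : nat -> nat, bijective p ->
  forall A : set borel_ngraph, measurable A ->
    pushforward mu (permute p) A = mu A.

(* Invariance of A is understood modulo mu, separately for each permutation.
   The group of all permutations is uncountable, and the universal K_s-free
   graphs form a single orbit of it, so with strictly invariant sets the
   condition would hold for every measure concentrated on these graphs. *)
Definition perm_ergodic (R : realType) (mu : probability borel_ngraph R) :=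
  forall A : set borel_ngraph, measurable A ->
    (forall p : nat -> nat, bijective p ->
       mu (A `+` (permute p @^-1` A)) = 0) ->
    mu A = 0 \/ mu A = 1.

(* Measures are functions on all sets, with arbitrary values on the
   non-measurable ones; two Borel measures are the same when their restrictions
   to the Borel sets are, so the restrictions are what has to be counted. *)
Definition uncountably_many (R : realType)
    (P : set (probability borel_ngraph R)) : Prop :=
  ~ countable [set sigL measurable mu | mu in P].

(* Main.v *)
(** Attach to every vertex an independent sequence of fair bits and join two
    vertices by a fixed rule applied to their sequences.  The sequences of a
    probability-one set are split into blocks 0, 1, 2, ...: block [n] consists of
    the sequences that begin with [4 n] but not with [4 n + 4] ones.  The rule is
    built block by block: a finite list of prefixes is chosen for block [n], and,
    as long as this creates no [K_s], all points of block [n] are joined to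
    exactly those points of earlier blocks that have a prefix in the list.
    Points of the same block are never joined, and the rule on blocks before [n]
    is locally constant, so a [K_(s-1)]-free set of sampled vertices can be
    thickened to a list of prefixes that is still admissible.  When every list is
    chosen for infinitely many blocks, the random graph therefore almost surely
    has the extension property that characterizes the universal [K_s]-free graph.
    Its law is invariant because the bits are exchangeable, and ergodic by the
    argument of the Hewitt-Savage zero-one law.  The lists chosen for the odd
    blocks are free parameters: they encode a bit sequence that can be recovered
    from the edge probability. *)
Require Import Defs.
From HB Require Import structures.
From mathcomp Require Import all_boot all_order all_algebra.
From mathcomp Require Import zify lra.
From mathcomp Require Import all_classical all_reals all_analysis.
From mathcomp Require Import measurable_realfun.

Set Implicit Arguments.
Unset Strict Implicit.
Unset Printing Implicit Defensive.

Import Order.TTheory GRing.Theory Num.Theory.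
Import numFieldNormedType.Exports.

Local Open Scope classical_set_scope.

(** * Extension property *)

Definition clique (V : Type) (G : rel V) (k : nat) (f : 'I_k -> V) :=
  forall i j, i != j -> G (f i) (f j).

(** Irreflexivity forces a map with pairwise adjacent images to be injective, so [clique] can do
    without an injectivity clause. *)
Lemma Kfree_clique (V : Type) (G : sgraph V) (s : nat) :
  Kfree s G <-> forall f : 'I_s -> V, ~ clique G f.
Proof.
split=> [K f cf|K [f [_ Gf]]]; last first.
  by apply: (K f) => i j ij; rewrite Gf.
apply: K; exists f; split=> [i j fij|i j].
  by apply/eqP/negP => /negP/cf; rewrite fij adj_irr.
have [->|ij] := eqVneq i j; first by rewrite !adj_irr.
by rewrite cf //= ij.
Qed.

Lemma clique_cons (V : Type) (G : sgraph V) k (f : 'I_k -> V) x :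
  (forall i, G x (f i)) -> clique G f ->
  clique G (fun i : 'I_k.+1 => oapp f x (unlift ord0 i)).
Proof.
move=> xf cf i j.
case: (unliftP ord0 i) => [i'|] ->; case: (unliftP ord0 j) => [j'|] -> //=.
- by rewrite (inj_eq lift_inj) => /cf.
- by rewrite adj_sym.
Qed.

(** A common neighbour of [A] creates no [K_s] exactly when [A] spans no clique of size [s.-1]. That
    [v] lies outside [A] is automatic, since [v] is adjacent to all of [A]; for [B] it has to be
    demanded. *)
Definition extension_property (s : nat) (G : ngraph) :=
  forall A B : seq nat, (forall a, a \in A -> a \notin B) ->
    (forall f : 'I_s.-1 -> nat, (forall i, f i \in A) -> ~ clique G f) ->
    exists v, [/\ v \notin B, forall a, a \in A -> G v a
                & forall b, b \in B -> ~~ G v b].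

(** * Finite partial isomorphisms and their one-point extension *)

Section PartialIsomorphism.
Variables (V : eqType) (H : sgraph V) (G : ngraph).

(** The list is the graph of a finite partial map; comparing equalities on both sides makes it
    single-valued and injective at once. *)
Definition piso (l : seq (V * nat)) := forall p q, p \in l -> q \in l ->
  (p.1 == q.1) = (p.2 == q.2) /\ H p.1 q.1 = G p.2 q.2.

(** The extension property is applied to the images of the neighbours and of the non-neighbours of
    [x]. A forbidden clique among the former would pull back to [H] and, together with [x], form a
    [K_s] there. *)
Lemma piso_extend s l x : (0 < s)%N -> Kfree s H -> extension_property s G ->
  piso l -> exists v, piso ((x, v) :: l).
Proof.
case: s => // s _ /Kfree_clique KH EG pl.
have [/mapP[p pil xp]|xl] := boolP (x \in [seq p.1 | p <- l]).
  exists p.2; have -> : (x, p.2) = p by rewrite xp -surjective_pairing.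
  move=> q r; rewrite !inE => q' r'.
  have ql : q \in l by case/orP: q' => // /eqP->.
  have rl : r \in l by case/orP: r' => // /eqP->.
  exact: pl.
have [|f fA cf|v [vB vA nvB]] := EG [seq p.2 | p <- l & H x p.1]
    [seq p.2 | p <- l & ~~ H x p.1].
- move=> _ /mapP[p + ->]; rewrite mem_filter => /andP[xp pil].
  apply/mapP => -[q]; rewrite mem_filter => /andP[xq qil] pq.
  have [] := pl _ _ pil qil; rewrite pq eqxx => /eqP e _.
  by rewrite -e xp in xq.
- have /choice[g gP] i : exists p, [/\ p \in l, H x p.1 & f i = p.2].
    by have /mapP[p + ->] := fA i; rewrite mem_filter => /andP[? ?]; exists p.
  apply: (KH _ (@clique_cons _ H _ (fun i => (g i).1) x _ _)).
    by move=> i; have [] := gP i.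
  move=> i j ij; have [gi _ fi] := gP i; have [gj _ fj] := gP j.
  by have [_ ->] := pl _ _ gi gj; rewrite -fi -fj; exact: cf.
exists v.
have xE q : q \in l -> (x == q.1) = (v == q.2) /\ H x q.1 = G v q.2.
  move=> ql; have -> : (x == q.1) = false.
    by apply: contraNF xl => /eqP->; exact: map_f.
  have [xq|xq] := boolP (H x q.1).
    have vq : G v q.2 by apply/vA/map_f; rewrite mem_filter xq.
    by split=> //; apply/esym; apply: contraTF vq => /eqP->; rewrite adj_irr.
  have qB : q.2 \in [seq p.2 | p <- l & ~~ H x p.1].
    by apply/map_f; rewrite mem_filter xq.
  split; last by apply/esym/negbTE/nvB.
  by apply/esym; apply: contraNF vB => /eqP->.
move=> q r; rewrite !inE => /orP[/eqP->|ql] /orP[/eqP->|rl] /=.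
- by rewrite !eqxx !adj_irr.
- exact: xE.
- by have [] := xE _ ql; rewrite eq_sym [v == _]eq_sym adj_sym [G v _]adj_sym.
- exact: pl.
Qed.

Lemma piso_embed s (e : seq V) : (0 < s)%N -> Kfree s H ->
  extension_property s G ->
  exists l, piso l /\ {subset e <= [seq p.1 | p <- l]}.
Proof.
move=> s0 KH EG; elim: e => [|x e [l [pl el]]]; first by exists [::].
have [v pv] := piso_extend x s0 KH EG pl.
exists ((x, v) :: l); split=> // y; rewrite !inE /= => /orP[->//|/el ->].
by rewrite orbT.
Qed.

End PartialIsomorphism.

Lemma extension_embeds s (G : ngraph) (V : finType) (H : sgraph V) :
  (0 < s)%N -> extension_property s G -> Kfree s H -> embeds H G.
Proof.
move=> s0 EG KH; have [l [pl el]] := piso_embed (enum V) s0 KH EG.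
have /choice[f fl] x : exists v, (x, v) \in l.
  have /el/mapP[[y v] yl /= ->] : x \in enum V by rewrite mem_enum.
  by exists v.
exists f; split=> [x y fxy|x y].
  by have [+ _] := pl _ _ (fl x) (fl y); rewrite /= fxy eqxx => /eqP.
by have [_ ->] := pl _ _ (fl x) (fl y).
Qed.

(** * Back-and-forth construction of automorphisms *)

Section Homogeneous.
Variables (s : nat) (G : ngraph).
Hypotheses (s0 : (0 < s)%N) (KG : Kfree s G) (EG : extension_property s G).

Let piso := @piso nat G G.

Lemma piso_swap (l : seq (nat * nat)) :
  piso l -> piso [seq (p.2, p.1) | p <- l].
Proof.
by move=> pl _ _ /mapP[p pil ->] /mapP[q qil ->] /=; have [-> ->] := pl _ _ pil qil.
Qed.

Lemma piso_back_and_forth (l : seq (nat * nat)) n : piso l ->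
  exists l', [/\ piso l', {subset l <= l'},
    n \in [seq p.1 | p <- l'] & n \in [seq p.2 | p <- l']].
Proof.
move=> /(piso_extend n s0 KG EG)[v] /piso_swap.
move=> /(piso_extend n s0 KG EG)[w] /piso_swap pl.
eexists; split; first exact: pl.
- move=> p pil; rewrite /= -map_comp !inE; apply/orP; right; apply/orP; right.
  by apply/mapP; exists p => //=; rewrite -surjective_pairing.
- by rewrite /= !inE eqxx orbT.
- by rewrite /= !inE eqxx.
Qed.

Lemma piso_automorphism (l : seq (nat * nat)) : piso l ->
  exists h, automorphism G h /\ forall p, p \in l -> h p.1 = p.2.
Proof.
move=> pl.
(* [F] must be total, so lists that are not partial isomorphisms receive the dummy value [[::]]. *)
have /choice[F FP] (nl : nat * seq (nat * nat)) : exists l', piso nl.2 ->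
    [/\ piso l', {subset nl.2 <= l'},
    nl.1 \in [seq p.1 | p <- l'] & nl.1 \in [seq p.2 | p <- l']].
  have [pn|pn] := pselect (piso nl.2); last by exists [::].
  by have [l' ?] := piso_back_and_forth nl.1 pn; exists l'.
(* Passing from [L n] to [L n.+1] puts [n] into both domain and range, so the union of the chain is
   a bijection of the vertices. *)
pose L := fix L n := if n is m.+1 then F (m, L m) else l.
have pL n : piso (L n).
  by elim: n => //= n ih; have [] := FP (n, L n) ih.
have LS m n : (m <= n)%N -> {subset L m <= L n}.
  elim: n => [|n ih]; first by rewrite leqn0 => /eqP->.
  rewrite leq_eqVlt => /orP[/eqP->//|/ih mn] p /mn pn.
  by have [_ + _ _] := FP (n, L n) (pL n); apply.
have pLL p q m n : p \in L m -> q \in L n ->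
    (p.1 == q.1) = (p.2 == q.2) /\ G p.1 q.1 = G p.2 q.2.
  move=> pm qn; apply: (pL (maxn m n)).
    exact: LS (leq_maxl _ _) _ pm.
  exact: LS (leq_maxr _ _) _ qn.
have /choice[h hP] x : exists y, exists n, (x, y) \in L n.
  have [_ _ /mapP[[u v] uv /= ->] _] := FP (x, L x) (pL x).
  by exists v; exists x.+1.
have /choice[k kP] y : exists x, exists n, (x, y) \in L n.
  have [_ _ _ /mapP[[u v] uv /= ->]] := FP (y, L y) (pL y).
  by exists u; exists y.+1.
exists h; split; last first.
  move=> p pil; have [n xn] := hP p.1.
  have [+ _] := pLL _ _ n 0%N xn pil.
  by rewrite /= eqxx => /esym/eqP.
split.
  exists k => x.
    have [n xn] := hP x; have [m ym] := kP (h x).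
    by have [+ _] := pLL _ _ n m xn ym; rewrite /= eqxx => /eqP.
  have [n xn] := kP x; have [m ym] := hP (k x).
  by have [+ _] := pLL _ _ n m xn ym; rewrite /= eqxx => /esym/eqP.
move=> x y; have [n xn] := hP x; have [m ym] := hP y.
by have [_] := pLL _ _ n m xn ym.
Qed.

Lemma extension_homogeneous : homogeneous G.
Proof.
move=> A B f /finite_seqP[a ->] _ [_ injf _] Gf.
have [|h [hG hf]] := @piso_automorphism [seq (x, f x) | x <- a].
  move=> _ _ /mapP[x xa ->] /mapP[y ya ->] /=; split; last by rewrite Gf.
  apply/eqP/eqP => [->//|fxy]; by apply: injf => //; rewrite inE.
exists h; split=> // x xa.
by have := hf (x, f x); apply; apply: map_f.
Qed.

End Homogeneous.

Lemma extension_universal s (G : ngraph) : (0 < s)%N -> Kfree s G ->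
  extension_property s G -> universal_Kfree s G.
Proof.
move=> s0 KG EG; split=> //; last exact: (extension_homogeneous s0 KG EG).
by move=> V H; exact: extension_embeds.
Qed.

(** * The graph on bit sequences *)

Lemma eventually_all (T : eqType) (s : seq T) (P : T -> nat -> Prop) :
  (forall a, a \in s -> exists N, forall n, (N <= n)%N -> P a n) ->
  exists N, forall a, a \in s -> forall n, (N <= n)%N -> P a n.
Proof.
elim: s => [|a s ih] sP; first by exists 0%N.
have [|N NP] := ih; first by move=> b bs; apply: sP; rewrite inE bs orbT.
have [|M MP] := sP a; first by rewrite inE eqxx.
exists (maxn M N) => b; rewrite inE => /orP[/eqP->|bs] n; rewrite geq_max.
  by move=> /andP[Mn _]; exact: MP.
by move=> /andP[_ Nn]; exact: NP.
Qed.

Notation bits := (nat -> bool).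

Definition agree (L : nat) (x y : bits) := forall i, (i < L)%N -> x i = y i.

Lemma agree_le L M x y : (L <= M)%N -> agree M x y -> agree L x y.
Proof. by move=> LM xy i iL; apply: xy; exact: leq_trans LM. Qed.

Lemma agree_mkseq L x y : agree L x y -> mkseq x L = mkseq y L.
Proof.
move=> xy; apply: (@eq_from_nth _ false); rewrite !size_mkseq// => i iL.
by rewrite !nth_mkseq ?xy.
Qed.

Lemma mkseq_agree L x y : mkseq x L = mkseq y L -> agree L x y.
Proof.
move=> xy i iL; have := congr1 (fun s => nth false s i) xy.
by rewrite !nth_mkseq.
Qed.

(* [x] lies in one of the blocks 0, ..., n - 1. *)
Definition below (n : nat) (x : bits) := ~~ all x (iota 0 (4 * n)).

Definition block (n : nat) (x : bits) := ~~ below n x && below n.+1 x.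

Definition has_prefix (c : seq (seq bool)) (x : bits) :=
  has (fun w => mkseq x (size w) == w) c.

Lemma below_le m n x : (m <= n)%N -> below m x -> below n x.
Proof.
move=> mn; apply: contra => /allP xn; apply/allP => i im; apply: xn.
move: im; rewrite !mem_iota !add0n /= => /leq_trans; apply.
by rewrite leq_mul2l mn orbT.
Qed.

Lemma below_agree n L x y : (4 * n <= L)%N -> agree L x y -> below n x = below n y.
Proof.
move=> nL xy; congr (~~ _); apply: eq_in_all => i; rewrite mem_iota add0n.
by move=> /= iN; apply: xy; exact: leq_trans nL.
Qed.

Lemma block_agree n L x y : (4 * n.+1 <= L)%N -> agree L x y -> block n x = block n y.
Proof.
move=> nL xy; rewrite /block (below_agree nL xy) (@below_agree n L x y) //.
by apply: leq_trans nL; rewrite leq_mul2l leqnSn orbT.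
Qed.

Lemma block_below m n x : block m x -> below n x = (m < n)%N.
Proof.
move=> /andP[xm xSm]; have [mn|nm] := ltnP m n; first exact: below_le xSm.
by apply/negbTE/negP => /(below_le nm); exact/negP.
Qed.

Lemma block_inj m n x : block m x -> block n x -> m = n.
Proof.
move=> xm xn; apply/eqP; rewrite eqn_leq.
by case/andP: (xn) (xm) => + _ => /[swap] /block_below->; rewrite -leqNgt => ->;
  case/andP: (xm) (xn) => + _ => /[swap] /block_below->; rewrite -leqNgt => ->.
Qed.

Lemma has_prefix_agree c : exists L, forall x y, agree L x y ->
  has_prefix c x = has_prefix c y.
Proof.
exists (\max_(w <- c) size w) => x y xy; apply: eq_in_has => w wc.
rewrite (@agree_mkseq (size w) x y)//; apply: agree_le xy.
exact: leq_bigmax_seq.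
Qed.

(** * The block-by-block rule: clique-freeness, local constancy and extension *)

Section BlockGraph.
Variables (k : nat) (c : nat -> seq (seq bool)).

(** The list stands for a clopen set of sequences. If that set spans no [k]-clique, joining new,
    mutually non-adjacent points to it creates no clique of size [k.+1]. *)
Definition admissible (E : rel bits) (C : seq (seq bool)) :=
  `[< forall f : 'I_k -> bits, (forall i, has_prefix C (f i)) -> ~ clique E f >].

Definition new_edge (E : rel bits) n (x y : bits) :=
  [&& block n x, below n y, admissible E (c n) & has_prefix (c n) y].

(* [stage n] is the limit graph restricted to the blocks 0, ..., n - 1. *)
Fixpoint stage n : rel bits := if n is m.+1 then
  fun x y => [|| stage m x y, new_edge (stage m) m x y | new_edge (stage m) m y x]
  else fun _ _ => false.

Definition limit_adj (x y : bits) := `[< exists n, stage n x y >].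

Lemma stage_sym n : symmetric (stage n).
Proof. by elim: n => //= n ih x y; rewrite ih [X in _ || X]orbC. Qed.

Lemma stage_below n x y : stage n x y -> below n x && below n y.
Proof.
elim: n => //= n ih /or3P[/ih/andP[xn yn]||].
- by rewrite !(@below_le n n.+1).
- by move=> /and4P[/andP[_ ->] /(below_le (leqnSn n)) ->].
- by move=> /and4P[/andP[_ ->] /(below_le (leqnSn n)) ->].
Qed.

(** Every edge added at step [n] has an endpoint in block [n], so later steps leave pairs from
    earlier blocks untouched. *)
Lemma stageE m n x y : (m <= n)%N -> below m x -> below m y ->
  stage n x y = stage m x y.
Proof.
move=> mn xm ym; elim: n mn => [|n ih]; first by rewrite leqn0 => /eqP->.
rewrite leq_eqVlt => /orP[/eqP->//|]; rewrite ltnS /= => mn; rewrite ih//.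
by rewrite /new_edge /block (below_le mn xm) (below_le mn ym) /= orbF.
Qed.

Lemma stage_irr n x : stage n x x = false.
Proof.
elim: n => //= n ->; rewrite /new_edge /block.
by case: (below n x); rewrite /= ?andbF.
Qed.

Lemma stage_block m n x y : block m x -> block m y -> stage n x y = false.
Proof.
move=> xm ym; elim: n => //= n ->; rewrite /new_edge.
rewrite (block_below n xm) (block_below n ym).
have [mn|] := ltnP m n; last by rewrite !andbF.
suff nB z : block m z -> block n z = false by rewrite !nB.
by move=> zm; apply/negbTE/negP => /(block_inj zm) e; rewrite e ltnn in mn.
Qed.

Lemma limit_adj_stage n x y : below n x -> below n y ->
  limit_adj x y = stage n x y.
Proof.
move=> xn yn; apply/idP/idP => [/asboolP[m xy]|xy]; last by apply/asboolP; exists n.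
have [/stageE <-//|/ltnW nm] := leqP n m.
by have /andP[xm ym] := stage_below xy; rewrite (stageE nm).
Qed.

Lemma limit_adj_block n x y : block n x -> below n y ->
  limit_adj x y = admissible (stage n) (c n) && has_prefix (c n) y.
Proof.
move=> xn yn; rewrite (@limit_adj_stage n.+1); last 2 first.
- by rewrite (block_below _ xn).
- exact: below_le yn.
rewrite /= /new_edge xn yn /= /block yn /= orbF.
case sxy: (stage n x y) => //.
by have /andP[] := stage_below sxy; rewrite (block_below _ xn) ltnn.
Qed.

Lemma limit_adj_sym : symmetric limit_adj.
Proof. by move=> x y; apply: asbool_equiv_eq; split=> -[n]; rewrite stage_sym; exists n. Qed.

Lemma limit_adj_irr : irreflexive limit_adj.
Proof. by move=> x; apply/negbTE/asboolPn => -[n]; rewrite stage_irr. Qed.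

(** Points of block [n] are pairwise non-adjacent, so a clique has at most one vertex there. Its
    other [k] vertices would then form a clique inside the chosen clopen set, against
    admissibility. *)
Lemma stage_Kfree n (f : 'I_k.+1 -> bits) : (0 < k)%N -> ~ clique (stage n) f.
Proof.
move=> k0; elim: n f => [f|n ih f cf].
  by move=> /(_ ord0 (lift ord0 (Ordinal k0))); rewrite neq_lift => /(_ isT).
have [fb|/existsNP[i0 fi0]] := pselect (forall i, below n (f i)).
  apply: (ih f) => i j /cf; rewrite (@stageE n n.+1) //.
(* As [f i0] is not below [n], its edges can only be new ones with [f i0] as the endpoint in block
   [n]. *)
have new j : i0 != j -> [&& below n (f j), admissible (stage n) (c n)
    & has_prefix (c n) (f j)].
  move=> /cf /= /or3P[||].
  - by move=> /stage_below /andP[/fi0].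
  - by move=> /and4P[_ -> -> ->].
  - by move=> /and4P[_ /fi0].
have adm : admissible (stage n) (c n).
  by case/and3P: (new _ (neq_lift i0 (Ordinal k0))).
move/asboolP: adm => /(_ (fun i => f (lift i0 i))); apply.
  by move=> i; case/and3P: (new _ (neq_lift i0 i)).
move=> i j ij; case/and3P: (new _ (neq_lift i0 i)) => ni _ _.
case/and3P: (new _ (neq_lift i0 j)) => nj _ _.
by rewrite -(@stageE n n.+1) //; apply: cf; rewrite (inj_eq lift_inj).
Qed.

Lemma limit_adj_Kfree (f : 'I_k.+1 -> bits) : (0 < k)%N -> ~ clique limit_adj f.
Proof.
move=> k0 cf.
(* Every clique vertex has a neighbour because [0 < k], hence lies in some block; finitely many
   vertices fit into one stage. *)
have [|N NP] := @eventually_all _ (enum 'I_k.+1) (fun i n => below n (f i)).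
  move=> i _; have [j ij] : exists j, i != j.
    exists (lift i (Ordinal k0)); exact: neq_lift.
  have /asboolP[n /stage_below /andP[fi _]] := cf _ _ ij.
  by exists n => m nm; exact: below_le fi.
have fN i : below N (f i) by apply: NP; rewrite ?mem_enum.
by apply: (@stage_Kfree N f k0) => i j /cf; rewrite (@limit_adj_stage N).
Qed.

Lemma stage_agree n : exists L, forall x x' y y',
  agree L x x' -> agree L y y' -> stage n x y = stage n x' y'.
Proof.
elim: n => [|n [L LP]]; first by exists 0%N.
have [M MP] := has_prefix_agree (c n).
exists (maxn L (maxn M (4 * n.+1))) => x x' y y' xx' yy' /=.
have nM : (4 * n.+1 <= maxn L (maxn M (4 * n.+1)))%N by rewrite !leq_max leqnn !orbT.
have nM' : (4 * n <= maxn L (maxn M (4 * n.+1)))%N.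
  by apply: leq_trans nM; rewrite leq_mul2l leqnSn orbT.
rewrite /new_edge (block_agree nM xx') (block_agree nM yy').
rewrite (below_agree nM' xx') (below_agree nM' yy').
rewrite (LP x x' y y'); last 2 first.
- by apply: agree_le xx'; rewrite leq_max leqnn.
- by apply: agree_le yy'; rewrite leq_max leqnn.
by rewrite (MP x x') ?(MP y y') //; [apply: agree_le yy'|apply: agree_le xx'];
  rewrite !leq_max leqnn ?orbT.
Qed.

Definition row_graph (x : nat -> bits) : ngraph :=
  @SGraph nat (fun i j => limit_adj (x i) (x j))
    (fun i j => limit_adj_sym (x i) (x j)) (fun i => limit_adj_irr (x i)).

Lemma row_graph_Kfree x : (0 < k)%N -> Kfree k.+1 (row_graph x).
Proof.
move=> k0; apply/Kfree_clique => f cf.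
exact: (@limit_adj_Kfree (fun i => x (f i)) k0).
Qed.

Lemma separating_length (x : nat -> bits) (s : seq nat) : injective x ->
  exists L, forall i j, i \in s -> j \in s -> forall M, (L <= M)%N ->
    agree M (x i) (x j) -> i = j.
Proof.
move=> injx.
have [|L LP] := @eventually_all _ (allpairs pair s s)
    (fun p n => agree n (x p.1) (x p.2) -> p.1 = p.2).
  move=> [i j] _ /=; have [e|ij] := pselect (x i = x j).
    by exists 0%N => n _ _; exact: injx.
  have [t xt] : exists t, x i t <> x j t.
    by apply/existsNP => e; apply: ij; exact/funext.
  by exists t.+1 => n tn /(_ t tn).
by exists L => i j si sj M LM; apply: (LP (i, j) _ M LM); exact: allpairs_f.
Qed.

Lemma row_graph_extension (x : nat -> bits) :
  (forall C N, exists2 n, (N <= n)%N & c n = C) ->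
  injective x -> (forall i, exists n, below n (x i)) ->
  (forall n, exists i, block n (x i)) ->
  extension_property k.+1 (row_graph x).
Proof.
move=> cC injx xb xB A B AB KA.
have [|N NP] := @eventually_all _ (A ++ B) (fun i n => below n (x i)).
  by move=> i _; have [n xn] := xb i; exists n => m nm; exact: below_le xn.
have [L1 L1P] := separating_length (A ++ B) injx.
have [L2 L2P] := stage_agree N.
(* Length [L] decides membership in the blocks before [N], separates the labels of [A ++ B], and
   determines adjacency in stage [N]. *)
pose L := maxn (4 * N) (maxn L1 L2).
have [LN LL1 LL2] : [/\ (4 * N <= L)%N, (L1 <= L)%N & (L2 <= L)%N].
  by rewrite !leq_max !leqnn !orbT.
have [n Nn cn] := cC [seq mkseq (x a) L | a <- A] N.
have cnP y : has_prefix (c n) y -> exists2 a, a \in A & agree L y (x a).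
  rewrite cn => /hasP[_ /mapP[a aA ->]]; rewrite size_mkseq => /eqP e.
  by exists a => //; exact: mkseq_agree.
have bel i : i \in A ++ B -> below N (x i) by move=> iAB; exact: NP.
have AAB i : i \in A -> i \in A ++ B by rewrite mem_cat => ->.
have BAB i : i \in B -> i \in A ++ B by rewrite mem_cat => ->; rewrite orbT.
have adm : admissible (stage n) (c n).
  (* A clique among the thickened labels is carried back to one in [A]: by the choice of [L], each
     point may be replaced by the label whose prefix it shares. *)
  apply/asboolP => f fc cf.
  have /choice[g gP] i : exists a, a \in A /\ agree L (f i) (x a).
    by have [a] := cnP _ (fc i); exists a.
  apply: (KA g) => [i|i j ij]; first by have [] := gP i.
  have [gi fi] := gP i; have [gj fj] := gP j.
  rewrite /= (@limit_adj_stage N) ?bel ?AAB//.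
  rewrite -(L2P (f i) (x (g i)) (f j) (x (g j))); last 2 first.
  - exact: agree_le fi.
  - exact: agree_le fj.
  rewrite -(stageE Nn) ?cf//.
  - by rewrite (below_agree LN fi) bel// AAB.
  - by rewrite (below_agree LN fj) bel// AAB.
(* Any vertex whose label falls in block [n] will do. As [N <= n], all labels of [A ++ B] lie in
   earlier blocks, so [v] is new and its adjacencies are read off from [c n]. *)
have [v vn] := xB n; exists v.
have adjv i : i \in A ++ B -> row_graph x v i = has_prefix (c n) (x i).
  by move=> /bel iN; rewrite /= (limit_adj_block vn) ?adm// (below_le Nn).
split=> [|a aA|b bB].
- apply/negP => /BAB /bel; rewrite (block_below _ vn).
  by rewrite ltnNge Nn.
- rewrite adjv ?AAB// cn; apply/hasP; exists (mkseq (x a) L).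
    exact: map_f.
  by rewrite size_mkseq.
- rewrite adjv ?BAB//; apply/negP => /cnP[a aA ba].
  have e : b = a by apply: (L1P _ _ _ _ L) => //; [exact: BAB|exact: AAB].
  by have := AB a aA; rewrite -e bB.
Qed.

End BlockGraph.

Local Open Scope ring_scope.

(** * Fair coin tosses *)

Lemma measurable_exists d (T : measurableType d) (X : countType)
    (P : X -> T -> Prop) : (forall a, measurable [set x | P a x]) ->
  measurable [set x | exists a, P a x].
Proof.
move=> mP.
have -> : [set x | exists a, P a x] =
    \bigcup_n (if unpickle n is Some a then [set x | P a x] else set0).
  apply/seteqP; split=> x; first by move=> [a Pax]; exists (pickle a); rewrite ?pickleK.
  by move=> [n _]; case: unpickle => // a; exists a.
by apply: bigcupT_measurable => n; case: unpickle.
Qed.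

Lemma measurable_forall d (T : measurableType d) (X : countType)
    (P : X -> T -> Prop) : (forall a, measurable [set x | P a x]) ->
  measurable [set x | forall a, P a x].
Proof.
move=> mP.
have -> : [set x | forall a, P a x] = ~` [set x | exists a, ~ P a x].
  apply/seteqP; split=> x /=; first by move=> Px [a] /(_ (Px a)).
  by move=> /forallNP Px a; apply: contrapT; exact: Px.
by apply: measurableC; apply: measurable_exists => a; exact: measurableC (mP a).
Qed.

Lemma measurable_impl d (T : measurableType d) (P Q : T -> Prop) :
  measurable [set x | P x] -> measurable [set x | Q x] ->
  measurable [set x | P x -> Q x].
Proof.
move=> mP mQ; have -> : [set x | P x -> Q x] = ~` [set x | P x] `|` [set x | Q x].
  apply/seteqP; split=> x /=; last by case.
  by have [Px /(_ Px)|] := pselect (P x); [right|left].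
exact: measurableU (measurableC mP) mQ.
Qed.

Lemma measurable_const d (T : measurableType d) (Q : Prop) : measurable [set _ : T | Q].
Proof.
have [q|q] := pselect Q.
  by rewrite (_ : mkset _ = setT) //; apply/seteqP; split.
by rewrite (_ : mkset _ = set0) //; apply/seteqP; split.
Qed.

Definition image_probability d d' (T : measurableType d) (T' : measurableType d')
    (R : realType) (P : probability T R) (f : T -> T')
    (mf : measurable_fun [set: T] f) : probability T' R :=
  distribution P (mfun_Sub (mem_set mf)).

Lemma image_probabilityE d d' (T : measurableType d) (T' : measurableType d')
    (R : realType) (P : probability T R) (f : T -> T')
    (mf : measurable_fun [set: T] f) A : image_probability P mf A = P (f @^-1` A).
Proof. by []. Qed.

Lemma uniq_map_inj (T U : eqType) (f : T -> U) (s : seq T) :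
  uniq (map f s) -> {in s &, injective f}.
Proof.
elim: s => //= a s ih /andP[fa us] x y; rewrite !inE.
move=> /orP[/eqP->|xs] /orP[/eqP->|ys] // fxy.
- by rewrite fxy map_f in fa.
- by rewrite -fxy map_f in fa.
- exact: ih.
Qed.

(** * Binary digits as independent bits under Lebesgue measure *)

Section BinaryDigits.
Variable R : realType.

Definition doubling (x : R) : R := if 2^-1 <= x then 2 * x - 1 else 2 * x.

Definition digit (n : nat) (x : R) : bool := 2^-1 <= iter n doubling x.

(** The doubling map shifts digits, so prescribing one more leading digit takes the preimage of a
    dyadic interval under one of its two branches and halves its length. *)
Lemma digit_interval n (w : nat -> bool) : exists a : R,
  [/\ 0 <= a, a + 2^-1 ^+ n <= 1 & forall x, 0 <= x < 1 ->
     (forall k, (k < n)%N -> digit k x = w k) <-> a <= x < a + 2^-1 ^+ n].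
Proof.
elim: n w => [|n ih] w.
  by exists 0; split; rewrite ?expr0 ?add0r // => x ->; split.
have [a [a0 a1 aP]] := ih (fun k => w k.+1).
(* This is the inverse branch of doubling selected by the first digit. *)
exists ((a + (w 0%N)%:R) / 2).
have e : 2^-1 ^+ n.+1 = 2^-1 ^+ n / 2 :> R by rewrite exprSr.
rewrite e; set h := 2^-1 ^+ n in a1 aP *.
split=> [||x x01].
- by case: (w 0%N); rewrite /=; lra.
- by case: (w 0%N); rewrite /=; lra.
have d01 : 0 <= doubling x < 1.
  by rewrite /doubling; case: ifPn => ?; lra.
have -> : (forall k, (k < n.+1)%N -> digit k x = w k) <->
    digit 0 x = w 0%N /\ a <= doubling x < a + h.
  split=> [H|[H0 /(aP _ d01) H] [|k] kn]; first split; first exact: H.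
  - by apply/(aP _ d01) => k kn; rewrite -H// /digit iterSr.
  - by [].
  - by rewrite -H// /digit iterSr.
rewrite /digit /doubling /=; case: ifPn => xh; case: (w 0%N) => /=.
- by split=> [[_ ?]|?]; [lra|split=> //; lra].
- by split=> [[]//|?]; lra.
- by split=> [[]//|?]; lra.
- by split=> [[_ ?]|?]; [lra|split=> //; lra].
Qed.

Lemma measurable_doubling : measurable_fun [set: R] doubling.
Proof.
apply: measurable_fun_ifT => /=.
- by apply: measurable_fun_ler.
- by apply: measurable_funB => //; exact: measurable_funM.
- exact: measurable_funM.
Qed.

Lemma measurable_digit n b : measurable [set x : R | digit n x = b].
Proof.
have m k : measurable_fun [set: R] (iter k doubling).
  by elim: k => [|k ih] /=; [exact: measurable_id|exact: measurableT_comp measurable_doubling ih].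
have md : measurable_fun [set: R] (digit n) by exact: measurable_fun_ler.
rewrite -[X in measurable X]setTI.
by apply: (md measurableT [set b]).
Qed.

Definition unit_interval_measure :=
  mrestr (@lebesgue_measure R) (measurable_itv `[0, 1[).

HB.instance Definition _ := Measure.on unit_interval_measure.

Lemma unit_interval_measureT : unit_interval_measure setT = 1%E.
Proof.
by rewrite /unit_interval_measure /mrestr setTI lebesgue_measure_itv /= lte_fin ltr01 -EFinB subr0.
Qed.

HB.instance Definition _ := Measure_isProbability.Build _ _ R
  unit_interval_measure unit_interval_measureT.

Lemma digit_prefix_measure n (w : nat -> bool) :
  unit_interval_measure [set x | forall k, (k < n)%N -> digit k x = w k] =
  (2^-1 ^+ n)%:E.
Proof.
have [a [a0 a1 aP]] := digit_interval n w.
have h0 : 0 < 2^-1 ^+ n :> R by rewrite exprn_gt0 // invr_gt0.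
rewrite /unit_interval_measure /mrestr.
rewrite (_ : _ `&` _ = `[a, a + 2^-1 ^+ n[%classic); last first.
  apply/seteqP; split=> x /=; rewrite !in_itv /=.
    by move=> [H x01]; apply/(aP x x01).
  move=> xa; have x01 : 0 <= x < 1 by lra.
  by split=> //; apply/aP.
rewrite lebesgue_measure_itv /= lte_fin ltrDl h0 -EFinB.
by congr EFin; lra.
Qed.

Lemma measurable_digits (l : seq (nat * bool)) :
  measurable [set x : R | forall p, p \in l -> digit p.1 x = p.2].
Proof.
apply: measurable_forall => p; apply: measurable_impl; last exact: measurable_digit.
exact: measurable_const.
Qed.

(** Induction on the number of free positions below a bound [N]: fixing one more position splits the
    event into two halves, until a full prefix of length [N] is prescribed. *)
Lemma digits_measure (l : seq (nat * bool)) : uniq (unzip1 l) ->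
  unit_interval_measure [set x | forall p, p \in l -> digit p.1 x = p.2] =
  (2^-1 ^+ size l)%:E.
Proof.
have [N] : exists N, forall k, k \in unzip1 l -> (k < N)%N.
  exists (\max_(k <- unzip1 l) k).+1 => k kl; rewrite ltnS.
  exact: (leq_bigmax_seq (P := xpredT) (F := id)).
move: {2}(N - size l)%N (leqnn (N - size l)) => m.
elim: m l => [|m ih] l Nl lN ul.
  have sl : (size (unzip1 l) <= N)%N.
    by rewrite -(size_iota 0 N); apply: uniq_leq_size => // k /lN; rewrite mem_iota.
  have sE : size (unzip1 l) = N.
    by apply/eqP; rewrite eqn_leq sl size_map -subn_eq0 -leqn0.
  have lE : unzip1 l =i iota 0 N.
    have [] := @uniq_min_size _ (unzip1 l) (iota 0 N) ul.
    - by move=> k /lN; rewrite mem_iota.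
    - by rewrite sE size_iota.
    - by [].
  rewrite -(size_map fst) sE -(digit_prefix_measure N (fun k => (k, true) \in l)).
  congr unit_interval_measure; apply/seteqP; split=> x /= H.
    move=> k kN; have : k \in unzip1 l by rewrite lE mem_iota.
    move=> /mapP[[k' b] kb /= ->]; rewrite (H _ kb) /=; case: b kb => [->//|kf].
    by apply/esym/negbTE/negP => kt; have := uniq_map_inj ul kf kt erefl.
  move=> [k b] kl /=; rewrite H; last by have := lN k; apply; exact: map_f kl.
  by case: b kl => [//|kf]; apply/negP => kt; have := uniq_map_inj ul kf kt erefl.
have [lN'|lN'] := leqP (N - size l) m; first exact: ih lN' lN ul.
have [k kN kl] : exists2 k, (k < N)%N & k \notin unzip1 l.
  apply: contrapT => H.
  suff : (N <= size l)%N by rewrite -subn_eq0 => /eqP e; rewrite e in lN'.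
  rewrite -(size_map fst) -(size_iota 0 N); apply: uniq_leq_size (iota_uniq _ _) _.
  move=> k; rewrite mem_iota add0n => kN; apply/negPn/negP => kl.
  by apply: H; exists k.
have Nl' : (N - (size l).+1 <= m)%N by rewrite subnS; lia.
pose S b := [set x : R | forall p, p \in (k, b) :: l -> digit p.1 x = p.2].
have SE b : unit_interval_measure (S b) = (2^-1 ^+ (size l).+1)%:E.
  apply: ih => //=; last by rewrite kl.
  by move=> j; rewrite inE => /orP[/eqP->|/lN].
have -> : [set x : R | forall p, p \in l -> digit p.1 x = p.2] = S true `|` S false.
  apply/seteqP; split=> x /=.
    move=> H; case dk: (digit k x); [left|right] => p;
    by rewrite inE => /orP[/eqP->|/H].
  by move=> [] H p pl; apply: H; rewrite inE pl orbT.
transitivity (unit_interval_measure (S true) + unit_interval_measure (S false))%E.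
  apply: measureU; [exact: measurable_digits|exact: measurable_digits|].
  apply/seteqP; split=> x //= -[xt xf].
  have kt := xt (k, true) (mem_head _ _).
  by have := xf (k, false) (mem_head _ _); rewrite /= kt.
by rewrite !SE -EFinD exprS; congr EFin; lra.
Qed.

End BinaryDigits.

(** * The product measure of fair coins and independence of coordinates *)

Section CoinSpace.
Variables (R : realType) (I : countType).

(** Contradictory lists are allowed and give the empty set, so intersection is plain
    concatenation. *)
Definition cylinder (l : seq (I * bool)) : set (I -> bool) :=
  [set w | forall p, p \in l -> w p.1 = p.2].

Definition coins := g_sigma_algebraType (range cylinder).

Definition depends_on (J : pred I) (A : set coins) :=
  forall w w', (forall i, J i -> w i = w' i) -> A w -> A w'.

Lemma cylinder_nil : cylinder [::] = setT.
Proof. by apply/seteqP; split. Qed.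

Lemma cylinder_cat l l' : cylinder (l ++ l') = cylinder l `&` cylinder l'.
Proof.
apply/seteqP; split=> w /=.
  by move=> H; split=> p pl; apply: H; rewrite mem_cat pl ?orbT.
by move=> [Hl Hl'] p; rewrite mem_cat => /orP[/Hl|/Hl'].
Qed.

Lemma cylinder_undup l : cylinder (undup l) = cylinder l.
Proof. by apply/seteqP; split=> w H p; have := H p; rewrite mem_undup. Qed.

Lemma measurable_cylinder l : measurable (cylinder l : set coins).
Proof. by apply: sub_sigma_algebra; exists l. Qed.

Lemma measurable_coins d (T : measurableType d) (f : T -> coins) :
  (forall i b, measurable [set x | f x i = b]) -> measurable_fun [set: T] f.
Proof.
move=> mf; apply: (@measurability _ _ T coins _ f (range cylinder)) => //.
move=> _ [_ [l _ <-] <-]; rewrite setTI.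
apply: measurable_forall => p; apply: measurable_impl; last exact: mf.
exact: measurable_const.
Qed.

Lemma measurable_coordinate i b : measurable [set w : coins | w i = b].
Proof.
have := measurable_cylinder [:: (i, b)]; congr (measurable _).
apply/seteqP; split=> w /= H => [|p]; last by rewrite inE => /eqP->.
exact: (H (i, b) (mem_head _ _)).
Qed.

(** The numbering [pickle] assigns distinct digit positions to distinct indices, so a uniform real
    supplies all coins at once. *)
Definition binary_expansion (x : R) : coins := fun i => digit (pickle i) x.

Lemma measurable_binary_expansion : measurable_fun [set: R] binary_expansion.
Proof. by apply: measurable_coins => i b; exact: measurable_digit. Qed.

Definition fair_coins : probability coins R :=
  image_probability (@unit_interval_measure R) measurable_binary_expansion.

Lemma fair_coins_uniq l : uniq (unzip1 l) ->
  fair_coins (cylinder l) = (2^-1 ^+ size l)%:E.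
Proof.
move=> ul; rewrite -(size_map (fun p => (pickle p.1, p.2))) -digits_measure; last first.
  have -> : unzip1 [seq (pickle p.1, p.2) | p <- l] = map pickle (unzip1 l).
    by rewrite /unzip1 -!map_comp.
  by rewrite map_inj_uniq //; exact: pcan_inj pickleK.
congr (unit_interval_measure _); apply/seteqP; split=> x /= H.
  by move=> _ /mapP[p pl ->]; exact: H.
by move=> p pl; have := H (pickle p.1, p.2); apply;
  exact: (map_f (fun p => (pickle p.1, p.2))).
Qed.

(** After removal of duplicates, an index that still occurs twice carries contradictory values,
    whence the weight 0. *)
Definition cylinder_weight (l : seq (I * bool)) : R :=
  if uniq (unzip1 (undup l)) then 2^-1 ^+ size (undup l) else 0.

Lemma fair_coins_cylinder l : fair_coins (cylinder l) = (cylinder_weight l)%:E.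
Proof.
rewrite /cylinder_weight -cylinder_undup; case: ifPn => [|nu]; first exact: fair_coins_uniq.
suff -> : cylinder (undup l) = set0 by rewrite measure0.
apply/seteqP; split=> w // wl; move: nu; rewrite map_inj_in_uniq ?undup_uniq//.
by move=> [i b] [j c] /wl /= <- /wl /= <- ->.
Qed.

Lemma fair_coins_unique (m : probability coins R) :
  (forall l, m (cylinder l) = fair_coins (cylinder l)) ->
  forall A, measurable A -> m A = fair_coins A.
Proof.
move=> mE A mA; apply: (@measure_unique _ R coins (range cylinder) (fun=> setT)) => //.
- move=> _ _ [l _ <-] [l' _ <-]; rewrite -cylinder_cat; by exists (l ++ l').
- by move=> _; rewrite -cylinder_nil; exists [::].
- by apply/seteqP; split=> // w _; exists 0%N.
- by move=> _ [l _ <-]; exact: mE.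
- by move=> _; apply: le_lt_trans (probability_le1 m measurableT) (ltry 1).
Qed.

Definition relabel (t : I -> I) (w : coins) : coins := fun i => w (t i).

Lemma measurable_relabel t : measurable_fun [set: coins] (relabel t).
Proof. by apply: measurable_coins => i b; exact: measurable_coordinate. Qed.

Lemma measurable_relabel_preimage t A : measurable A -> measurable (relabel t @^-1` A).
Proof. by move=> mA; rewrite -[X in measurable X]setTI; exact: measurable_relabel. Qed.

(** By uniqueness it suffices to look at cylinders, and an injective relabelling preserves the
    number and the consistency of their constraints. *)
Lemma fair_coins_relabel t A : injective t -> measurable A ->
  fair_coins (relabel t @^-1` A) = fair_coins A.
Proof.
move=> injt mA; rewrite -(image_probabilityE fair_coins (measurable_relabel t)).
apply: fair_coins_unique => // l; rewrite image_probabilityE.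
pose g (p : I * bool) := (t p.1, p.2).
have injg : injective g by move=> [i b] [j c] [/injt -> ->].
have -> : relabel t @^-1` cylinder l = cylinder (map g l).
  apply/seteqP; split=> w H p; first by move=> /mapP[q ql ->]; exact: H.
  by move=> pl; exact: (H (g p) (map_f g pl)).
rewrite !fair_coins_cylinder /cylinder_weight undup_map_inj// size_map.
have -> : unzip1 (map g (undup l)) = map t (unzip1 (undup l)).
  by rewrite /unzip1 -!map_comp.
by rewrite map_inj_uniq.
Qed.

(* Independence comes from splicing: taking the coordinates in [J] from one
   sample and the others from an independent one gives again a fair sample. *)
Definition merge (J : pred I) (w : coins * coins) : coins :=
  fun i => if J i then w.1 i else w.2 i.

Lemma measurable_merge J : measurable_fun [set: coins * coins] (merge J).
Proof.
apply: measurable_coins => i b.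
have [Ji|Ji] := boolP (J i).
  rewrite (_ : mkset _ = [set w : coins | w i = b] `*` setT).
    by apply: measurableX => //; exact: measurable_coordinate.
  by apply/seteqP; split=> w; rewrite /= /merge Ji //; case.
rewrite (_ : mkset _ = setT `*` [set w : coins | w i = b]).
  by apply: measurableX => //; exact: measurable_coordinate.
by apply/seteqP; split=> w; rewrite /= /merge (negbTE Ji) //; case.
Qed.

Lemma cylinder_weight_split (J : pred I) l : cylinder_weight l =
  cylinder_weight [seq p <- l | J p.1] * cylinder_weight ([seq p <- l | ~~ J p.1]).
Proof.
rewrite /cylinder_weight -!filter_undup; set u := undup l.
have pu : perm_eq (unzip1 u)
    (unzip1 [seq p <- u | J p.1] ++ unzip1 [seq p <- u | ~~ J p.1]).
  rewrite -map_cat; apply: perm_map; rewrite perm_sym; exact: permEl (perm_filterC _ _).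
rewrite (perm_uniq pu) cat_uniq.
have -> : has (mem (unzip1 [seq p <- u | J p.1]))
    (unzip1 [seq p <- u | ~~ J p.1]) = false.
  apply/negbTE/hasPn => _ /mapP[p + ->]; rewrite mem_filter => /andP[/= pJ _].
  by apply/mapP => -[q]; rewrite mem_filter => /andP[/= qJ _] e; rewrite e qJ in pJ.
rewrite /= -(size_map fst u) (perm_size pu) size_cat !size_map exprD.
by case: uniq; case: uniq; rewrite /= ?mul0r ?mulr0.
Qed.

Lemma fair_coins_merge (J : pred I) A : measurable A ->
  (fair_coins \x fair_coins)%E (merge J @^-1` A) = fair_coins A.
Proof.
move=> mA; rewrite -(image_probabilityE (fair_coins \x fair_coins)%E (measurable_merge J)).
apply: fair_coins_unique => // l; rewrite image_probabilityE.
have -> : merge J @^-1` cylinder l =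
    cylinder [seq p <- l | J p.1] `*` cylinder ([seq p <- l | ~~ J p.1]).
  apply/seteqP; split=> [w H|w [H1 H2] p pl].
    split=> p; rewrite mem_filter => /andP[/= Jp /H]; rewrite /merge ?Jp//.
    by rewrite (negbTE Jp).
  rewrite /merge; case: ifPn => Jp; [apply: H1|apply: H2];
    by rewrite mem_filter /= ?Jp.
apply: etrans (product_measure1E _ _ (measurable_cylinder _) (measurable_cylinder _)) _.
by rewrite fair_coins_cylinder (cylinder_weight_split J) EFinM -!fair_coins_cylinder.
Qed.

(** On a spliced sample [A] sees only the first component and [B] only the second, so the event
    becomes the rectangle of [A] and [B]. *)
Lemma fair_coins_independent (J : pred I) (A B : set coins) :
  measurable A -> measurable B -> depends_on J A -> depends_on (predC J) B ->
  fair_coins (A `&` B) = (fair_coins A * fair_coins B)%E.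
Proof.
move=> mA mB dA dB; rewrite -(fair_coins_merge J); last exact: measurableI.
apply: etrans (product_measure1E _ _ mA mB).
congr (_ _); apply/seteqP; split=> -[w1 w2] /=.
  move=> [Am Bm]; split; [apply: dA Am|apply: dB Bm] => i /=; rewrite /merge /=.
    by move=> ->.
  by move=> /negbTE->.
move=> [Aw Bw]; split; [apply: dA Aw|apply: dB Bw] => i /=; rewrite /merge /=.
  by move=> ->.
by move=> /negbTE->.
Qed.

End CoinSpace.

(** * Ergodicity *)

Lemma setYI_sub (T : Type) (A A' C C' : set T) :
  A `+` (C `&` C') `<=` (A `+` C) `|` ((A `+` A') `|` (A' `+` C')).
Proof.
move=> w; have := (pselect (A w), pselect (A' w), pselect (C w), pselect (C' w)).
by rewrite /setY /setD /setU /setI /=; tauto.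
Qed.

Section SymmetricDifference.
Context d (T : measurableType d) (R : realType) (P : probability T R).
Implicit Types A B C : set T.

Lemma measurable_setY A B : measurable A -> measurable B -> measurable (A `+` B).
Proof. by move=> mA mB; apply: measurableU; apply: measurableD. Qed.

Lemma probability_fineK A : measurable A -> (fine (P A))%:E = P A.
Proof. by move=> mA; rewrite fineK// fin_num_measure. Qed.

Lemma fine_probability_le A B : measurable A -> measurable B -> A `<=` B ->
  fine (P A) <= fine (P B).
Proof.
move=> mA mB AB; rewrite -lee_fin !probability_fineK//.
by apply: le_measure => //; rewrite inE.
Qed.

Lemma fine_probabilityU A B : measurable A -> measurable B ->
  fine (P (A `|` B)) <= fine (P A) + fine (P B).
Proof.
move=> mA mB; rewrite -lee_fin EFinD !probability_fineK//; last exact: measurableU.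
exact: measureU2.
Qed.

Lemma fine_probability_setY A B : measurable A -> measurable B ->
  `|fine (P A) - fine (P B)| <= fine (P (A `+` B)).
Proof.
move=> mA mB; have mY := measurable_setY mA mB.
rewrite ler_norml; apply/andP; split.
  rewrite lerBrDr addrC lerBlDr.
  apply: le_trans (fine_probabilityU mA mY).
  apply: fine_probability_le => //; first exact: measurableU.
  by move=> w Bw; have [|nA] := pselect (A w); [left|right; right].
rewrite lerBlDr addrC; apply: le_trans (fine_probabilityU mB mY).
apply: fine_probability_le => //; first exact: measurableU.
by move=> w Aw; have [|nB] := pselect (B w); [left|right; left].
Qed.

Lemma fine_probability_cover A B C : measurable A -> measurable B -> measurable C ->
  A `<=` B `|` C -> fine (P A) <= fine (P B) + fine (P C).
Proof.
move=> mA mB mC ABC; apply: le_trans (fine_probabilityU mB mC).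
by apply: fine_probability_le => //; exact: measurableU.
Qed.

End SymmetricDifference.

Section Ergodicity.
Variable R : realType.
Notation sites := (nat * nat)%type.
Notation omega := (coins sites).
Notation P := (fair_coins R sites).

Definition rows_below (k : nat) : pred sites := fun i => (i.1 < k)%N.

Definition approximable (A : set omega) := measurable A /\
  forall e : R, 0 < e -> exists k (C : set omega),
    [/\ measurable C, depends_on (rows_below k) C & fine (P (A `+` C)) <= e].

Lemma approximable_cylinder l : approximable (cylinder l).
Proof.
split=> [|e e0]; first exact: measurable_cylinder.
exists (\max_(p <- l) p.1.1).+1, (cylinder l); split.
- exact: measurable_cylinder.
- move=> w w' ww' H p pl; rewrite -ww' ?H//.
  by rewrite /rows_below ltnS; exact: (leq_bigmax_seq (P := xpredT) (F := fun p => p.1.1)).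
- by rewrite setYK measure0 ltW.
Qed.

Lemma approximableD A B : approximable A -> approximable B -> approximable (A `\` B).
Proof.
move=> [mA hA] [mB hB]; split=> [|e e0]; first exact: measurableD.
have e2 : 0 < e / 2 by lra.
have [k [C [mC dC AC]]] := hA _ e2; have [m [D [mD dD BD]]] := hB _ e2.
exists (maxn k m), (C `\` D); split; first exact: measurableD.
- move=> w w' ww' [Cw Dw]; split.
    by apply: dC Cw => i ik; apply: ww'; rewrite /rows_below leq_max [X in X || _]ik.
  apply: contra_not Dw; apply: dD => i im; apply/esym/ww'.
  by rewrite /rows_below leq_max [X in _ || X]im orbT.
- apply: le_trans (_ : fine (P (A `+` C)) + fine (P (B `+` D)) <= e); last by lra.
  apply: (fine_probability_cover P).
  + by apply: measurable_setY; exact: measurableD.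
  + exact: measurable_setY.
  + exact: measurable_setY.
  move=> w; have := (pselect (A w), pselect (B w), pselect (C w), pselect (D w)).
  by rewrite /setY /setD /setU /=; tauto.
Qed.

(** Dynkin's argument: the cylinders are stable under intersection, and approximable events form a
    lambda-system containing them. *)
Lemma approximable_measurable A : measurable A -> approximable A.
Proof.
have := @lambda_system_subset _ (range (@cylinder sites)) _ setT approximable.
move=> H; apply: H => //; last by move=> _ [l _ <-]; exact: approximable_cylinder.
  by move=> _ _ [l _ <-] [l' _ <-]; rewrite -cylinder_cat; exists (l ++ l').
split=> //.
- by rewrite -cylinder_nil; exact: approximable_cylinder.
- by move=> B C _; exact: approximableD.
move=> /= F ndF aF; have mF n : measurable (F n : set omega) by have [] := aF n.
have mU : measurable (\bigcup_n F n : set omega) by exact: bigcupT_measurable.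
split=> // e e0; have e2 : 0 < e / 2 by lra.
(* By continuity from below some [F N] is within [e / 2] of the union, and [F N] is itself
   approximable within [e / 2]. *)
have : P (F n) @[n --> \oo] --> (fine (P (\bigcup_n F n)))%:E.
  by rewrite (probability_fineK P mU); exact: nondecreasing_cvg_mu.
move=> /fine_cvg /cvgrPdist_le /(_ _ e2).
move=> [N _ /(_ N (leqnn N))] /= hN.
have [_ /(_ _ e2)[k [C [mC dC FC]]]] := aF N.
exists k, C; split=> //.
have FU : F N `<=` \bigcup_n F n by move=> w Fw; exists N.
apply: le_trans (_ : fine (P (\bigcup_n F n `\` F N)) + fine (P (F N `+` C)) <= e).
  apply: (fine_probability_cover P).
  + exact: measurable_setY mU mC.
  + exact: measurableD mU (mF N).
  + exact: measurable_setY (mF N) mC.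
  move=> w; have := (pselect (F N w), pselect (C w)); have := FU w.
  by rewrite /setY /setD /setU /=; tauto.
have -> : P (\bigcup_n F n `\` F N) = (P (\bigcup_n F n) - P (F N))%E.
  rewrite measureD// ?setIidr//; exact: le_lt_trans (probability_le1 P mU) (ltry 1).
rewrite fineB ?fin_num_measure//.
by have := ler_norm (fine (P (\bigcup_n F n)) - fine (P (F N))); lra.
Qed.

Definition permute_rows (p : nat -> nat) : omega -> omega :=
  relabel (fun i : sites => (p i.1, i.2)).

(** Exchanges the rows before [k] with the next [k] rows, so an event on the former gets an
    independent copy. *)
Definition swap_below (k i : nat) : nat :=
  if (i < k)%N then (i + k)%N else if (i < k + k)%N then (i - k)%N else i.

Lemma swap_belowK k : involutive (swap_below k).
Proof. by move=> i; rewrite /swap_below; do ! case: ifP; lia. Qed.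

Lemma permute_rows_inj (p : nat -> nat) : bijective p ->
  injective (fun i : sites => (p i.1, i.2)).
Proof. by move=> /bij_inj pI [i j] [i' j'] /= [/pI -> ->]. Qed.

Lemma fair_coins_ergodic (A : set omega) : measurable A ->
  (forall p, bijective p -> P (A `+` (permute_rows p @^-1` A)) = 0%E) ->
  P A = 0%E \/ P A = 1%E.
Proof.
move=> mA invA; set a := fine (P A).
have aE : P A = a%:E by rewrite /a probability_fineK.
have a0 : 0 <= a by rewrite /a fine_ge0// measure_ge0.
have a1 : a <= 1 by rewrite -lee_fin -aE probability_le1.
(* Approximate [A] by [C], and compare [C] with an independent copy of itself. *)
suff close (e : R) : 0 < e -> a - a * a <= 4 * e.
  (* Otherwise [close] at one eighth of [a - a * a] would bound this positive number by half of
     itself. *)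
  have : a - a * a <= 0.
    rewrite leNgt; apply/negP => ha; have /close : 0 < (a - a * a) / 8 by lra.
    lra.
  rewrite aE; have [->|an0] := eqVneq a 0; first by left.
  have a_gt0 : 0 < a by rewrite lt0r an0.
  move=> h; right; have : 1 <= a by rewrite -(ler_pM2l a_gt0) mulr1; lra.
  by move=> ?; congr EFin; lra.
move=> e0; have [_ /(_ _ e0)[k [C [mC dC AC]]]] := approximable_measurable mA.
pose p := swap_below k.
have bp : bijective p by exists p; exact: swap_belowK.
pose A' := permute_rows p @^-1` A; pose C' := permute_rows p @^-1` C.
have mA' : measurable A' by exact: measurable_relabel_preimage.
have mC' : measurable C' by exact: measurable_relabel_preimage.
have CC : P (C `&` C') = (P C * P C)%E.
  rewrite (fair_coins_independent R mC mC' dC).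
    by rewrite (fair_coins_relabel R (permute_rows_inj bp) mC).
  move=> w w' ww'; apply: dC => -[i j] /= ik; apply: ww' => /=.
  by move: ik; rewrite /rows_below /p /swap_below /= => ->; lia.
set c := fine (P C).
have cE : P C = c%:E by rewrite /c probability_fineK.
have c0 : 0 <= c by rewrite /c fine_ge0// measure_ge0.
have c1 : c <= 1 by rewrite -lee_fin -cE probability_le1.
have ac : `|a - c| <= e := le_trans (fine_probability_setY P mA mC) AC.
have mCC : measurable (C `&` C') by exact: measurableI.
have acc : `|a - c * c| <= e + e.
  have -> : c * c = fine (P (C `&` C')) by rewrite CC cE.
  apply: le_trans (fine_probability_setY P mA mCC) _.
  have := @fine_probability_cover _ _ _ P (A `+` (C `&` C')) (A `+` C)
     ((A `+` A') `|` (A' `+` C')).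
  move=> /(_ (measurable_setY mA mCC) (measurable_setY mA mC)).
  move=> /(_ (measurableU _ _ (measurable_setY mA mA') (measurable_setY mA' mC'))).
  have h : A `+` (C `&` C') `<=` (A `+` C) `|` ((A `+` A') `|` (A' `+` C')).
    exact: setYI_sub.
  move=> /(_ h) /le_trans; apply; apply: lerD => //.
  apply: le_trans (fine_probabilityU P (measurable_setY mA mA') (measurable_setY mA' mC')) _.
  rewrite invA// add0r.
  have -> : A' `+` C' = permute_rows p @^-1` (A `+` C) by [].
  by rewrite (fair_coins_relabel R (permute_rows_inj bp))//; exact: measurable_setY.
(* Here [a - a * a] is the sum of [a - c * c], at most [2 * e], and [c * c - a * a], at most [2 * e]
   because [a] and [c] are at most 1 and differ by at most [e]. *)
move: ac acc; rewrite !ler_norml => /andP[? ?] /andP[? ?]; nra.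
Qed.

End Ergodicity.

(** * Measurability in the space of graphs *)

Lemma sgraph_ext (V : Type) (G H : sgraph V) : adj G = adj H -> G = H.
Proof.
case: G H => [g gs gi] [h hs hi] /= e; rewrite {}e in gs gi *.
by rewrite (Prop_irrelevance gs hs) (Prop_irrelevance gi hi).
Qed.

Definition agree_filter (I : eqType) (x : I -> bool) : set_system (I -> bool) :=
  [set A | exists s : seq I, forall g, (forall i, i \in s -> g i = x i) -> A g].

Lemma agree_filter_filter (I : eqType) (x : I -> bool) : Filter (agree_filter x).
Proof.
split; first by exists [::].
- move=> A B [s sA] [t tB]; exists (s ++ t) => g gx.
  by split; [apply: sA|apply: tB] => i ii; apply: gx; rewrite mem_cat ii ?orbT.
- by move=> A B AB [s sA]; exists s => g /sA /AB.
Qed.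

(** The filter of sets that contain all functions agreeing with the matrix of [G] on some finite set
    of entries converges coordinatewise, hence in the product topology, to that matrix. *)
Lemma open_ngraph_finitary (U : set ngraph) (G : ngraph) : open U -> U G ->
  exists s : seq (nat * nat), forall H : ngraph,
    (forall i, i \in s -> H i.1 i.2 = G i.1 i.2) -> U H.
Proof.
move=> [V oV <-] /= VG.
have FF := agree_filter_filter (adjmx G).
have : agree_filter (adjmx G) --> (adjmx G : prod_topology (fun _ : nat * nat => bool)).
  apply/cvg_sup => i A; rewrite nbhsE => -[B [[C oC <-] BG] BA].
  by exists [:: i] => g gG; apply: BA; rewrite /= gG ?mem_head.
move=> /(_ V); have : nbhs (adjmx G) V by apply: open_nbhs_nbhs; split.
move=> nV /(_ nV)[s sV]; exists s => H HG.
exact: sV.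
Qed.

Lemma open_edge i j b : open [set G : ngraph | G i j = b].
Proof.
exists [set g | g (i, j) = b] => //.
have -> : [set g : prod_topology (fun _ : nat * nat => bool) | g (i, j) = b] =
  @proj _ (fun _ : nat * nat => bool) (i, j) @^-1` [set b] by [].
apply: open_comp; last exact: discrete_open.
by move=> ? _; exact: proj_continuous.
Qed.

Lemma measurable_edge i j b : measurable [set G : borel_ngraph | G i j = b].
Proof. by apply: sub_sigma_algebra; exact: open_edge. Qed.

(** An open set is the union of the finite edge conditions that force membership in it; there are
    countably many, namely the [good] lists. *)
Lemma measurable_ngraph d (T : measurableType d) (f : T -> borel_ngraph) :
  (forall i j b, measurable [set x | f x i j = b]) -> measurable_fun [set: T] f.
Proof.
move=> mf; apply: (@measurability _ _ T borel_ngraph _ f (@open ngraph)) => //.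
move=> _ [U oU <-]; rewrite setTI.
pose good (l : seq ((nat * nat) * bool)) := forall H : ngraph,
  (forall p, p \in l -> H p.1.1 p.1.2 = p.2) -> U H.
have -> : f @^-1` U =
    [set x | exists l, good l /\ forall p, p \in l -> f x p.1.1 p.1.2 = p.2].
  apply/seteqP; split=> x /=; last by move=> [l [gl]] /gl.
  move=> /(open_ngraph_finitary oU)[s sU].
  exists [seq (i, f x i.1 i.2) | i <- s]; split; last by move=> _ /mapP[i _ ->].
  move=> H Hf; apply: sU => i si.
  exact: (Hf (i, f x i.1 i.2) (map_f (fun i => (i, f x i.1 i.2)) si)).
apply: measurable_exists => l.
have -> : [set x | good l /\ forall p, p \in l -> f x p.1.1 p.1.2 = p.2] =
    [set x | good l] `&` [set x | forall p, p \in l -> f x p.1.1 p.1.2 = p.2] by [].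
apply: measurableI; first exact: measurable_const.
apply: measurable_forall => p; apply: measurable_impl; last exact: mf.
exact: measurable_const.
Qed.

Lemma measurable_forall_fun d (T : measurableType d) (I : finType) (X : countType)
    (Q : (I -> X) -> T -> Prop) : (forall f, measurable [set x | Q f x]) ->
  measurable [set x | forall f, Q f x].
Proof.
move=> mQ; have -> : [set x | forall f, Q f x] = [set x | forall f : {ffun I -> X}, Q f x].
  apply/seteqP; split=> x //= Qx f; have := Qx (finfun f).
  by congr (Q _ x); apply/funext => i; rewrite ffunE.
by apply: measurable_forall => f; exact: mQ.
Qed.

Lemma measurable_not_clique k (f : 'I_k -> nat) :
  measurable [set G : borel_ngraph | ~ clique G f].
Proof.
apply: measurableC; apply: measurable_forall => i; apply: measurable_forall => j.
by apply: measurable_impl; [exact: measurable_const|exact: measurable_edge].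
Qed.

Lemma measurable_Kfree s : measurable [set G : borel_ngraph | Kfree s G].
Proof.
have -> : [set G : borel_ngraph | Kfree s G] =
    [set G : borel_ngraph | forall f : 'I_s -> nat, ~ clique G f].
  by apply/seteqP; split=> G /Kfree_clique.
by apply: measurable_forall_fun => f; exact: measurable_not_clique.
Qed.

Lemma measurable_extension s : measurable [set G : borel_ngraph | extension_property s G].
Proof.
apply: measurable_forall => A; apply: measurable_forall => B.
apply: measurable_impl; first exact: measurable_const.
apply: measurable_impl.
  apply: measurable_forall_fun => f; apply: measurable_impl; first exact: measurable_const.
  exact: measurable_not_clique.
apply: measurable_exists => v.
rewrite (_ : mkset _ = [set _ | v \notin B] `&`
    ([set G : borel_ngraph | forall a, a \in A -> G v a]
    `&` [set G : borel_ngraph | forall b, b \in B -> ~~ G v b])); last first.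
  by apply/seteqP; split=> G /=; [case|case=> ? []].
apply: measurableI; first exact: measurable_const.
apply: measurableI; apply: measurable_forall => a;
  (apply: measurable_impl; first exact: measurable_const).
  exact: measurable_edge.
rewrite (_ : mkset _ = [set G : borel_ngraph | G v a = false]); first exact: measurable_edge.
by apply/seteqP; split=> G /= => [/negbTE|->].
Qed.

(** * The random graph *)

Lemma negligible_half_powers d (T : measurableType d) (R : realType)
    (P : probability T R) (A : set T) (F : nat -> set T) :
  (forall n, measurable (F n)) -> (forall n, A `<=` F n) ->
  (forall n, P (F n) = (2^-1 ^+ n)%:E) -> P.-negligible A.
Proof.
move=> mF AF PF; exists [set w | forall n, F n w]; split.
- by apply: measurable_forall => n; exact: mF.
- have mI : measurable [set w | forall n, F n w].
    by apply: measurable_forall => n; exact: mF.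
  apply/eqP; rewrite eq_le measure_ge0 andbT -(probability_fineK P mI) lee_fin.
  rewrite leNgt; apply/negP => x0.
  have h1 : `|2^-1 : R| < 1 by rewrite ger0_norm; lra.
  have /cvgrPdist_lt /(_ _ x0)[N _ /(_ N (leqnn N))] := cvg_expr h1.
  rewrite /= sub0r normrN ger0_norm ?exprn_ge0 ?invr_ge0// ltNge => /negP; apply.
  rewrite -lee_fin (probability_fineK P mI) -PF.
  by apply: le_measure; rewrite ?inE// => w; apply.
- by move=> w Aw n; exact: AF.
Qed.

(** * Almost sure properties of the vertex labels *)

Section FairCoinSequences.
Variable R : realType.
Notation sites := (nat * nat)%type.
Notation omega := (coins sites).
Notation P := (fair_coins R sites).

Definition label (w : omega) (i : nat) : bits := fun l => w (i, l).

Lemma measurable_label_agree i j L :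
  measurable [set w : omega | agree L (label w i) (label w j)].
Proof.
apply: measurable_forall => l; apply: measurable_impl; first exact: measurable_const.
rewrite (_ : mkset _ = [set w : omega | exists b, w (i, l) = b /\ w (j, l) = b]).
  apply: measurable_exists => b.
  by apply: (measurableI _ _ (measurable_coordinate _ _) (measurable_coordinate _ _)).
by apply/seteqP; split=> w /=; [exists (w (i, l))|move=> [b []]; rewrite /label => -> ->].
Qed.

Lemma label_agree_measure i j L : i != j ->
  P [set w | agree L (label w i) (label w j)] = (2^-1 ^+ L)%:E.
Proof.
move=> ij; elim: L => [|L ih].
  rewrite (_ : mkset _ = setT) ?probability_setT//.
  by apply/seteqP; split.
pose E := [set w : omega | agree L (label w i) (label w j)].
pose C b : set omega := cylinder [:: ((i, L), b); ((j, L), b)].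
have mE : measurable E by exact: measurable_label_agree.
have mC b : measurable (C b) by exact: measurable_cylinder.
have PEC b : P (E `&` C b) = (2^-1 ^+ L * 2^-1 ^+ 2)%:E.
  (* The event [E] uses only columns before [L] and [C b] only column [L]. Two of the four outcomes
     of the new pair of bits keep the agreement. *)
  rewrite (@fair_coins_independent R _ (fun x : sites => (x.2 < L)%N))//.
  - rewrite ih fair_coins_uniq//= andbT inE.
    by apply: contra ij => /eqP[->].
  - by move=> w w' ww' Ew l lL; rewrite /label -!ww'//; exact: Ew.
  - move=> w w' ww' Cw p pC; rewrite -(Cw p pC); apply/esym/ww'.
    by move: pC; rewrite !inE => /orP[] /eqP-> /=; rewrite ltnn.
rewrite (_ : mkset _ = (E `&` C true) `|` (E `&` C false)); last first.
  apply/seteqP; split=> w /=.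
    move=> a; have aL : agree L (label w i) (label w j) by apply: agree_le a.
    have := a L (ltnSn L); rewrite /label => e.
    case b: (w (i, L)); [left|right]; split=> // p; rewrite !inE => /orP[]/eqP-> //=;
      by rewrite -?e.
  have aux b : (E `&` C b) w -> agree L.+1 (label w i) (label w j).
    move=> [Ew Cw] l; rewrite ltnS leq_eqVlt => /orP[/eqP->|]; last exact: Ew.
    have := Cw ((i, L), b); have := Cw ((j, L), b); rewrite !inE !eqxx orbT /label /=.
    by move=> -> // ->.
  by case; exact: aux.
transitivity (P (E `&` C true) + P (E `&` C false))%E.
  apply: measureU; [exact: measurableI|exact: measurableI|].
  apply/seteqP; split=> w //= -[[_ Ct] [_ Cf]].
  have := Ct ((i, L), true) (mem_head _ _).
  by rewrite (Cf ((i, L), false) (mem_head _ _)).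
by rewrite !PEC -EFinD expr2 (exprSr _ L); congr EFin; lra.
Qed.

Lemma ae_labels_distinct : {ae P, forall w, injective (label w)}.
Proof.
suff H i j : i != j -> {ae P, forall w, label w i <> label w j}.
  have : {ae P, forall w, forall i j, i != j -> label w i <> label w j}.
    apply: ae_foralln => i; apply: ae_foralln => j.
    have [->|/H] := eqVneq i j; first exact: aeW.
    by apply: filterS => w.
  apply: filterS => w Hw i j e; apply/eqP/negPn/negP => ij.
  exact: Hw ij e.
move=> ij; apply: (@negligible_half_powers _ _ _ P _
  (fun L => [set w | agree L (label w i) (label w j)])).
- by move=> L; exact: measurable_label_agree.
- by move=> L w /= /contrapT e l _; rewrite e.
- by move=> L; exact: label_agree_measure.
Qed.

Definition ones (i L : nat) : seq (sites * bool) := [seq ((i, l), true) | l <- iota 0 L].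

Lemma onesP i L (w : omega) : cylinder (ones i L) w <-> all (label w i) (iota 0 L).
Proof.
split=> [H|/allP H _ /mapP[l lL ->]]; last exact: H.
apply/allP => l lL; have := H ((i, l), true); apply.
by apply/mapP; exists l.
Qed.

Lemma ones_uniq i L : uniq (unzip1 (ones i L)).
Proof. by rewrite /unzip1 -map_comp map_inj_uniq ?iota_uniq// => l l' []. Qed.

Lemma size_ones i L : size (ones i L) = L.
Proof. by rewrite size_map size_iota. Qed.

(** Only the constant sequence of ones lies in no block, and it has probability 0. *)
Lemma ae_label_below : {ae P, forall w, forall i, exists n, below n (label w i)}.
Proof.
apply: ae_foralln => i.
apply: (@negligible_half_powers _ _ _ P _ (fun L => cylinder (ones i L))).
- by move=> L; exact: measurable_cylinder.
- move=> L w /= /forallNP H; apply/onesP; have /negP := H L.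
  rewrite negbK => /allP a; apply/allP => l; rewrite mem_iota => lL; apply: a.
  by rewrite mem_iota; lia.
- by move=> L; rewrite fair_coins_uniq ?ones_uniq// size_ones.
Qed.

(** Exactly [4 n] leading ones: a part of block [n] with the simple probability 2^-(4 n + 1). *)
Definition block_cylinder (i n : nat) : seq (sites * bool) :=
  ((i, (4 * n)%N), false) :: ones i (4 * n).

Lemma block_cylinderP i n (w : omega) : cylinder (block_cylinder i n) w ->
  block n (label w i).
Proof.
move=> H; rewrite /block /below negbK; apply/andP; split.
  by apply/onesP => p pl; apply: H; rewrite inE pl orbT.
apply/allPn; exists (4 * n)%N; first by rewrite mem_iota; lia.
by apply/negPf; exact: (H ((i, (4 * n)%N), false) (mem_head _ _)).
Qed.

Lemma block_cylinder_uniq i n : uniq (unzip1 (block_cylinder i n)).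
Proof.
rewrite /= ones_uniq andbT; apply/mapP => -[_ /mapP[l + ->] /= [e]].
by rewrite -e mem_iota; lia.
Qed.

Lemma measurable_label_below n i : measurable [set w : omega | below n (label w i)].
Proof.
rewrite (_ : mkset _ = ~` cylinder (ones i (4 * n))).
  by apply: measurableC; exact: measurable_cylinder.
apply/seteqP; split=> w /=; first by move=> /negP b /onesP.
by move=> h; apply/negP => /onesP.
Qed.

Lemma measurable_label_block n i : measurable [set w : omega | block n (label w i)].
Proof.
rewrite (_ : mkset _ = ~` [set w : omega | below n (label w i)] `&`
    [set w : omega | below n.+1 (label w i)]).
  by apply: measurableI; [apply: measurableC|]; exact: measurable_label_below.
by apply/seteqP; split=> w /= => [/andP[/negP]|[/negP ? ?]] //; apply/andP.
Qed.

(** The event is invariant under row permutations, so it has probability 0 or 1, and a single label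
    already meets block [n] with positive probability. *)
Lemma ae_blocks_occur : {ae P, forall w, forall n, exists i, block n (label w i)}.
Proof.
apply: ae_foralln => n; pose A := [set w : omega | exists i, block n (label w i)].
have mA : measurable A by apply: measurable_exists => i; exact: measurable_label_block.
suff : P A = 1%E.
  move=> A1; apply/negligibleP; first exact: measurableC.
  by rewrite [LHS]probability_setC// A1 subee.
have [p [q pK qK]|A0|//] := @fair_coins_ergodic R A mA.
  rewrite (_ : permute_rows p @^-1` A = A) ?setYK ?measure0//.
  apply/seteqP; split=> w [i wi]; first by exists (p i).
  by exists (q i); rewrite /label /permute_rows /relabel /= qK.
have : (P (cylinder (block_cylinder 0 n)) <= P A)%E.
  apply: le_measure; rewrite ?inE//; first exact: measurable_cylinder.
  by move=> w /block_cylinderP; exists 0%N.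
rewrite A0 fair_coins_uniq ?block_cylinder_uniq// lee_fin leNgt.
by rewrite exprn_gt0// invr_gt0.
Qed.

End FairCoinSequences.

Lemma finitary_measurable (I : countType) (A : set (coins I)) (s : seq I) :
  depends_on (mem s) A -> measurable A.
Proof.
move=> dA; rewrite (_ : A = [set w | exists l, cylinder l `<=` A /\ cylinder l w]).
  apply: measurable_exists => l.
  by apply: measurableI; [exact: measurable_const|exact: measurable_cylinder].
apply/seteqP; split=> w /=; last by move=> [l [lA lw]]; exact: lA.
move=> Aw; exists [seq (i, w i) | i <- s]; split; last by move=> _ /mapP[i _ ->].
move=> w' H; apply: dA Aw => i si; apply/esym.
exact: (H (i, w i) (map_f (fun i => (i, w i)) si)).
Qed.

(* The 2-adic valuation makes every list the code of infinitely many even [n];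
   the odd [n] carry [tau]. *)
Definition code (tau : nat -> bool) (n : nat) : seq (seq bool) :=
  if odd n then (if tau n./2 then [:: [:: false]] else [::])
  else odflt [::] (unpickle (logn 2 n).-1).

Lemma code_recurrent tau C N : exists2 n, (N <= n)%N & code tau n = C.
Proof.
(* The odd factor only makes the number large; the 2-adic valuation is the index of [C] plus one,
   which also makes the number even. *)
exists (2 ^ (pickle C).+1 * N.*2.+1)%N.
  have : (0 < 2 ^ (pickle C).+1)%N by rewrite expn_gt0.
  nia.
rewrite /code (_ : odd _ = false); last by rewrite oddM oddX.
rewrite lognM ?expn_gt0// pfactorK// (@logn_coprime 2 N.*2.+1).
  by rewrite addn0 succnK pickleK.
by rewrite coprime2n oddS odd_double.
Qed.

(** * The law of the sampled graph *)

Section Sampling.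
Variables (R : realType) (k : nat).
Hypothesis k1 : (1 < k)%N.
Notation sites := (nat * nat)%type.
Notation omega := (coins sites).
Notation P := (fair_coins R sites).

Lemma measurable_limit_adj c i j :
  measurable [set w : omega | limit_adj k c (label w i) (label w j)].
Proof.
rewrite (_ : mkset _ = [set w : omega | exists n, stage k c n (label w i) (label w j)]).
  apply: measurable_exists => n; have [L LP] := stage_agree k c n.
  apply: (@finitary_measurable _ _ (allpairs pair [:: i; j] (iota 0 L))).
  move=> w w' ww' /=; rewrite (LP _ (label w' i) _ (label w' j))// => l lL; apply: ww'.
    by apply: allpairs_f; rewrite ?mem_head ?mem_iota.
  by apply: allpairs_f; rewrite ?inE ?eqxx ?orbT ?mem_iota.
by apply/seteqP; split=> w /asboolP.
Qed.

Definition sample c (w : omega) : borel_ngraph := row_graph k c (label w).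

Lemma measurable_sample c : measurable_fun [set: omega] (sample c).
Proof.
apply: measurable_ngraph => i j [|]; first exact: measurable_limit_adj.
rewrite (_ : mkset _ = ~` [set w : omega | limit_adj k c (label w i) (label w j)]).
  exact: measurableC (measurable_limit_adj _ _ _).
by apply/seteqP; split=> w /= => [->|/negP/negbTE].
Qed.

Definition sample_law c : probability borel_ngraph R :=
  image_probability P (measurable_sample c).

Lemma permute_sample c p w : permute p (sample c w) = sample c (permute_rows p w).
Proof. exact: sgraph_ext. Qed.

Lemma measurable_sample_preimage c A : measurable A -> measurable (sample c @^-1` A).
Proof. by move=> mA; rewrite -[X in measurable X]setTI; exact: measurable_sample. Qed.

Lemma sample_lawE c A : sample_law c A = P (sample c @^-1` A).
Proof. by []. Qed.

Lemma sample_law_invariant c : perm_invariant (sample_law c).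
Proof.
move=> p bp A mA; transitivity (P (permute_rows p @^-1` (sample c @^-1` A))).
  rewrite -[LHS](sample_lawE c); congr (P _).
  by apply/seteqP; split=> w /=; rewrite permute_sample.
by rewrite (fair_coins_relabel R (permute_rows_inj bp) (measurable_sample_preimage c mA)).
Qed.

Lemma sample_law_ergodic c : perm_ergodic (sample_law c).
Proof.
move=> A mA invA; rewrite sample_lawE.
apply: fair_coins_ergodic => [|p bp]; first exact: measurable_sample_preimage.
apply: etrans (invA p bp); rewrite sample_lawE; congr (P _).
by apply/seteqP; split=> w; rewrite /setY /setU /setD /= permute_sample.
Qed.

Lemma sample_law_universal tau :
  {ae sample_law (code tau), forall G : borel_ngraph, universal_Kfree k.+1 G}.
Proof.
(* [good] is a Borel set of universal graphs, so its complement is a measurable null set covering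
   the exceptional graphs. *)
pose good := [set G : borel_ngraph | Kfree k.+1 G] `&`
  [set G : borel_ngraph | extension_property k.+1 G].
have mgood : measurable good.
  by apply: measurableI; [exact: measurable_Kfree|exact: measurable_extension].
exists (~` good); split; first exact: measurableC.
- rewrite sample_lawE; apply/negligibleP.
    exact: measurable_sample_preimage _ (measurableC mgood).
  have k0 : (0 < k)%N by exact: ltnW.
  have Hd := ae_labels_distinct R; have Hb := ae_label_below R; have Ho := ae_blocks_occur R.
  have : {ae P, forall w, good (sample (code tau) w)}.
    apply: filterS3 Hd Hb Ho => w inj bel occ; split; first exact: row_graph_Kfree.
    exact: row_graph_extension (code_recurrent tau) inj bel occ.
  by [].
- by move=> G /= nu [KG EG]; apply: nu; exact: extension_universal.
Qed.

(** * Recovering the parameter from the edge probability *)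

Lemma stage_eq c c' n : (forall m, (m < n)%N -> c m = c' m) -> stage k c n = stage k c' n.
Proof.
elim: n => //= n ih H; rewrite ih => [|m mn]; last by apply: H; exact: ltnW.
by apply/funext => x; apply/funext => y; rewrite /new_edge (H n).
Qed.

Lemma block0 (x : bits) : x 0%N = false -> block 0 x.
Proof. by move=> x0; rewrite /block /below /= x0. Qed.

(** All sequences starting with a zero lie in block 0 and are pairwise non-adjacent, while [1 < k]
    makes a clique contain an edge. *)
Lemma admissible_block0 c n : admissible k (stage k c n) [:: [:: false]].
Proof.
apply/asboolP => f fP; have fb i : block 0 (f i).
  by apply: block0; have := fP i; rewrite /has_prefix /= orbF => /eqP[].
move=> /(_ (Ordinal (ltnW k1)) (Ordinal k1) isT).
by rewrite (@stage_block k c 0).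
Qed.

Lemma measurable_edge01 : measurable [set G : borel_ngraph | G 0%N 1%N].
Proof. exact: measurable_edge. Qed.

(* At the first odd block [n] where the parameters differ, the pairs joined only
   under [tau] have probability at least 2^-(4 n + 2), while the pairs joined
   only under [tau'] involve a later block and have probability at most
   2 * 2^-(4 n + 4).  This is why blocks are cut off after four bits. *)
Lemma sample_law_edge_lt (tau tau' : bits) m :
  (forall j, (j < m)%N -> tau j = tau' j) -> tau m -> ~~ tau' m ->
  fine (sample_law (code tau') [set G : borel_ngraph | G 0%N 1%N]) <
  fine (sample_law (code tau) [set G : borel_ngraph | G 0%N 1%N]).
Proof.
move=> eqt tm tm'; rewrite !sample_lawE.
set D := sample (code tau) @^-1` _; set D' := sample (code tau') @^-1` _.
have mD : measurable D by exact: measurable_sample_preimage _ measurable_edge01.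
have mD' : measurable D' by exact: measurable_sample_preimage _ measurable_edge01.
have [n nE] : exists n, n = m.*2.+1 by exists m.*2.+1.
have code_n : code tau n = [:: [:: false]].
  by rewrite /code nE /= odd_double /= uphalf_double tm.
have code_n' : code tau' n = [::].
  by rewrite /code nE /= odd_double /= uphalf_double (negbTE tm').
have stE : stage k (code tau') n = stage k (code tau) n.
  apply: stage_eq => j jn; rewrite /code; case: ifP => // jo.
  by rewrite eqt//; rewrite nE in jn; lia.
(* Label 1 is put in block 0 by its initial zero and label 0 in block [n] by exactly [4 n] leading
   ones: [4 n + 2] fixed bits in all. *)
pose C : set omega := cylinder (((1%N, 0%N), false) :: block_cylinder 0 n).
have mC : measurable C by exact: measurable_cylinder.
have Csub w : C w -> D w /\ ~ D' w.
  move=> Cw; have w1 : label w 1 0 = false.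
    exact: (Cw ((1%N, 0%N), false) (mem_head _ _)).
  have b0 : block n (label w 0).
    by apply: block_cylinderP => p pl; apply: Cw; rewrite inE pl orbT.
  have l1 : below n (label w 1) by rewrite (block_below n (block0 w1)) nE.
  split.
    rewrite /D /= (limit_adj_block _ _ b0 l1) code_n admissible_block0 /=.
    by rewrite /has_prefix /mkseq /= w1.
  by rewrite /D' /= (limit_adj_block _ _ b0 l1) code_n' andbF.
(* Up to block [n] the rule for [tau'] adds nothing to the common stage [n], which is contained in
   the next stage for [tau]. *)
have D'sub w : D' w -> below n.+1 (label w 0) -> below n.+1 (label w 1) -> D w.
  rewrite /D' /D /= => D'w b0 b1; move: D'w.
  rewrite !(limit_adj_stage _ _ b0 b1) /= /new_edge stE code_n' !andbF !orbF.
  by move=> ->.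
pose U i : set omega := cylinder (ones i (4 * n.+1)).
have mU i : measurable (U i) by exact: measurable_cylinder.
have PU i : fine (P (U i)) = 2^-1 ^+ (4 * n.+1).
  by rewrite fair_coins_uniq ?ones_uniq// size_ones.
have PC : fine (P C) = 2^-1 ^+ (4 * n).+2.
  rewrite fair_coins_uniq; first by rewrite /= size_ones.
  apply/andP; split; last exact: block_cylinder_uniq.
  by rewrite /= inE negb_or /=; apply/mapP => -[_ /mapP[l _ ->]].
have mDD : measurable (D `&` D') by exact: measurableI.
have upper : fine (P D') <=
    fine (P (D `&` D')) + 2^-1 ^+ (4 * n.+1) + 2^-1 ^+ (4 * n.+1).
  rewrite -{1}(PU 0%N) -(PU 1%N).
  apply: le_trans (_ : fine (P (D `&` D' `|` U 0%N)) + fine (P (U 1%N)) <= _).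
    apply: (fine_probability_cover P) => //; first exact: measurableU.
    move=> w D'w; have [b0|b0] := boolP (below n.+1 (label w 0)).
      have [b1|b1] := boolP (below n.+1 (label w 1)).
        by left; left; split => //; exact: D'sub.
      by right; apply/onesP; rewrite negbK in b1.
    by left; right; apply/onesP; rewrite negbK in b0.
  by rewrite lerD2r; exact: fine_probabilityU.
have lower : fine (P (D `&` D')) + 2^-1 ^+ (4 * n).+2 <= fine (P D).
  rewrite -PC -lee_fin EFinD !probability_fineK// -measureU//.
    by apply: le_measure; rewrite ?inE//; [exact: measurableU|move=> w [[]//|/Csub[]]].
  by apply/seteqP; split=> w //= -[[_ D'w] /Csub[]].
apply: le_lt_trans upper _; apply: lt_le_trans lower.
have h0 : 0 < 2^-1 ^+ (4 * n) :> R by rewrite exprn_gt0// invr_gt0.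
have -> : (4 * n.+1 = (4 * n).+4)%N by rewrite mulnS; lia.
rewrite !exprS; move: h0; set h := 2^-1 ^+ (4 * n).
lra.
Qed.

Lemma sample_law_inj tau tau' :
  sigL measurable (sample_law (code tau)) = sigL measurable (sample_law (code tau')) ->
  tau = tau'.
Proof.
move=> e; apply/funext => m.
have eE : sample_law (code tau) [set G : borel_ngraph | G 0%N 1%N] =
    sample_law (code tau') [set G : borel_ngraph | G 0%N 1%N].
  pose E : set_type (measurable : set (set borel_ngraph)) :=
    SigSub (mem_set measurable_edge01).
  exact: (congr1 (fun f => f E) e).
(* Strong induction reduces to the first index where the parameters differ; there the edge
   probabilities are strictly ordered, in one direction or the other. *)
elim/ltn_ind: m => m ih; apply/eqP/negPn/negP.
case t: (tau m); case t': (tau' m) => // _.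
  have := @sample_law_edge_lt tau tau' m ih; rewrite t t' eE ltxx => /(_ isT isT).
  by [].
have ih' j : (j < m)%N -> tau' j = tau j by move=> /ih.
have := @sample_law_edge_lt tau' tau m ih'; rewrite t t' eE ltxx => /(_ isT isT).
by [].
Qed.

End Sampling.

(** Cantor's diagonal argument: [d] is built to differ at [f tau] from every [tau], hence from
    itself at [f d]. *)
Lemma uncountable_bits (f : (nat -> bool) -> nat) : ~ injective f.
Proof.
move=> injf; pose d n := `[< exists tau, f tau = n /\ tau n = false >].
have [/[dup] dd /asboolP[tau [/injf -> tf]]|/negP dd] := boolP (d (f d)).
  by rewrite tf in dd.
by apply: (dd); apply/asboolP; exists d; split=> //; apply/negbTE/negP.
Qed.

Theorem mainTheorem5 (R : realType) (s : nat) (hs : (2 < s)%N) :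
  uncountably_many
    [set mu : probability borel_ngraph R |
      [/\ perm_invariant mu, perm_ergodic mu
        & {ae mu, forall G : borel_ngraph, universal_Kfree s G}]].
Proof.
case: s hs => // k k1; set S := (X in uncountably_many X).
have lawS tau : S (sample_law R k (code tau)).
  split; [exact: sample_law_invariant|exact: sample_law_ergodic|].
  exact: sample_law_universal.
(* Composed with the injective map from parameters to restricted laws, an injection of a countable
   family into the integers would inject the bit sequences. *)
move=> /countable_injP[f injf].
apply: (@uncountable_bits
  (fun tau => f (sigL measurable (sample_law R k (code tau))))).
move=> tau tau' /injf e; apply: (sample_law_inj k1); apply: e.
  by rewrite inE; exists (sample_law R k (code tau)).
by rewrite inE; exists (sample_law R k (code tau')).
Qed.
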